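(* Let $G^S$ be a tree on the state node set $V^S$, and let the network $\mathcal G=G^S\cup G^I$ have $m\ge 2$ external input nodes $u_1,\dots,u_m$, attached to pairwise distinct state nodes $v_1,\dots,v_m$. Then $\mathcal G$ is strongly structurally controllable if and only if $V^S$ can be partitioned into $m$ disjoint sets $V_1^S,\dots,V_m^S$ such that, for each $r$, the subgraph of $G^S$ induced by $V_r^S$ is a path, $v_r\in V_r^S$, and $v_r$ is an endpoint of that path (i.e. each component $\mathcal G_r$, consisting of the path on $V_r^S$ with the single input $u_r$, is an SSC path network with its input at a terminal node); in such a decomposition any two distinct parts are joined by at most one edge of $G^S$.
   Context: Network model: a network $\mathcal G=G^S\cup G^I$ consists of an undirected simple state graph $G^S$ on state nodes $\{1,\dots,n\}$ and a set of $m$ external input nodes $u_1,\dots,u_m$, where each input node $u_r$ has exactly one directed edge, to a state node $v_r$, and the $v_r$ are pairwise distinct; the input matrix is $B=[e_{v_1},\dots,e_{v_m}]\in\mathbb R^{n\times m}$. The dynamics are $\dot x=Mx+Bu$, where $M$ ranges over the family $Q(G^S)$ of symmetric matrices with $M_{ij}=a_{ij}>0$ if $\{i,j\}$ is an edge of $G^S$, $M_{ij}=0$ if $i\ne j$ are non-adjacent, and $M_{ii}=-\sum_{j\in\mathcal N_i}a_{ij}+a_{ii}$ with an arbitrary self-loop weight $a_{ii}<0$ ($\mathcal N_i$ the neighbours of $i$ in $G^S$). The network is strongly structurally controllable (SSC) if for every $M\in Q(G^S)$ the controllability matrix $[B,MB,\dots,M^{n-1}B]$ has rank $n$. A path consisting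 of a single vertex has that vertex as its endpoint. *)

(* Defs.v *)
From HB Require Import structures.
From mathcomp Require Import all_boot all_order all_algebra.
From mathcomp Require Import reals.
Set Implicit Arguments. Unset Strict Implicit. Unset Printing Implicit Defensive.
Import Order.TTheory GRing.Theory Num.Theory.
Local Open Scope ring_scope.

Definition simple_graph (n : nat) (e : rel 'I_n) : Prop :=
  symmetric e /\ irreflexive e.

Definition connected_graph (n : nat) (e : rel 'I_n) : Prop :=
  forall x y : 'I_n, connect e x y.

Definition acyclic_graph (n : nat) (e : rel 'I_n) : Prop :=
  forall c : seq 'I_n, (3 <= size c)%N -> ~~ (cycle e c && uniq c).

Definition is_tree (n : nat) (e : rel 'I_n) : Prop :=
  simple_graph e /\ connected_graph e /\ acyclic_graph e.

Definition in_Q (R : realType) (n : nat) (e : rel 'I_n) (M : 'M[R]_n) : Prop :=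
  M^T = M /\
  (forall i j : 'I_n, i != j -> e i j -> 0 < M i j) /\
  (forall i j : 'I_n, i != j -> ~~ e i j -> M i j = 0) /\
  (forall i : 'I_n, exists a : R, a < 0 /\ M i i = - (\sum_(j | e i j) M i j) + a).

Definition input_matrix (R : realType) (n m : nat) (v : 'I_m -> 'I_n) : 'M[R]_(n, m) :=
  \matrix_(i < n, r < m) (i == v r)%:R.

Definition ctrb_matrix (R : realType) (n m : nat) (M : 'M[R]_n) (B : 'M[R]_(n, m)) :=
  \mxrow_(k < n) (M ^+ k *m B).

Definition SSC (R : realType) (n m : nat) (e : rel 'I_n) (v : 'I_m -> 'I_n) : Prop :=
  forall M : 'M[R]_n, in_Q e M -> \rank (ctrb_matrix M (input_matrix R v)) = n.

(* The subgraph of G^S induced by V is a path having x as one endpoint: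
   there is a duplicate-free enumeration x = p_0, p_1, ..., p_k of V such that
   two vertices of V are adjacent in G^S iff they are consecutive in it.
   (A single vertex is a path whose endpoint is that vertex.) *)
Definition consecutive (T : eqType) (p : seq T) (a b : T) : Prop :=
  exists i : nat, exists x0 : T, (i.+1 < size p)%N /\
    ((nth x0 p i = a /\ nth x0 p i.+1 = b) \/ (nth x0 p i = b /\ nth x0 p i.+1 = a)).

Definition induced_path_endpoint (n : nat) (e : rel 'I_n) (V : {set 'I_n}) (x : 'I_n) : Prop :=
  exists s : seq 'I_n,
    uniq (x :: s) /\ (forall y, (y \in V) = (y \in x :: s)) /\
    (forall a b : 'I_n, a \in V -> b \in V -> (e a b <-> consecutive (x :: s) a b)).

Definition path_decomposition (n m : nat) (e : rel 'I_n) (v : 'I_m -> 'I_n)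
    (V : 'I_m -> {set 'I_n}) : Prop :=
  (forall r s : 'I_m, r != s -> [disjoint V r & V s]) /\
  (forall y : 'I_n, exists r : 'I_m, y \in V r) /\
  (forall r : 'I_m, v r \in V r /\ induced_path_endpoint e (V r) (v r)).

Definition edges_between (n : nat) (e : rel 'I_n) (A B : {set 'I_n}) : nat :=
  #|[set p : 'I_n * 'I_n | (p.1 \in A) && (p.2 \in B) && e p.1 p.2]|.

(* Main.v *)
(* Both sides are equivalent to the absence of forts: nonempty sets S of vertices
   that avoid the inputs and such that no vertex outside S has exactly one
   neighbour in S.
   - The left kernel of the controllability matrix is M-invariant, and the set of
     coordinates on which it does not vanish is a fort.
   - Conversely a fort S supports an eigenvector of some M in Q(G^S): each edge
     leaving S enters the eigenvalue equation of only one vertex outside S, and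
     the equations at vertices of S are solved by the free diagonal entries.
   - Without forts, every proper set of vertices containing the inputs has a
     vertex with a unique neighbour outside it; adding these neighbours one at a
     time grows paths from the inputs until they cover the tree.
   - A fort in a path decomposition would yield a cycle in the tree. *)
Require Import Defs.
From HB Require Import structures.
From mathcomp Require Import all_boot all_order all_algebra.
From mathcomp Require Import reals zify ring.
Import Order.TTheory GRing.Theory Num.Theory.
Local Open Scope ring_scope.

(** * Bridges of a tree and induced paths *)

Definition del_edge {T : eqType} (e : rel T) (a b : T) : rel T :=
  [rel x y | e x y && ~~ ((x == a) && (y == b) || (x == b) && (y == a))].

Definition induced {T : finType} (e : rel T) (V : {set T}) : rel T :=
  [rel x y | [&& e x y, x \in V & y \in V]].

Lemma del_edge_sym (T : eqType) (e : rel T) (a b : T) :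
  symmetric e -> symmetric (del_edge e a b).
Proof.
move=> esym x y; rewrite /del_edge /= esym; congr (_ && ~~ _).
by rewrite orbC andbC [(x == a) && _]andbC.
Qed.

(** A simple path from [a] to [b] avoiding the edge has at least three vertices, so the edge would
    close it into a cycle. *)
Lemma tree_edge_is_bridge {n : nat} {e : rel 'I_n} {a b : 'I_n} :
  is_tree e -> e a b -> ~~ connect (del_edge e a b) a b.
Proof.
case=> -[esym eirr] [_ eacyc] eab; apply/negP => /connectP[p0 p0P p0b].
move: p0b; case/shortenP: p0P => p pP pU _ pb {p0}.
have pe : path e a p by apply: sub_path pP => x y /andP[].
case: p pP pU pe pb => [|c [|d p]] pP pU pe pb.
- by move: eab; rewrite pb /= eirr.
- by move: pP; rewrite pb /= /del_edge /= !eqxx andbF.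
have := eacyc [:: a, c, d & p] isT; rewrite pU andbT => /negP; apply.
by rewrite (cycle_path a) /= in pe pb *; rewrite -pb esym eab.
Qed.

Lemma connect_induced_del_edge {n : nat} {e : rel 'I_n} {V : {set 'I_n}}
    {a b x y : 'I_n} :
  ~~ ((a \in V) && (b \in V)) -> connect (induced e V) x y ->
  connect (del_edge e a b) x y.
Proof.
move=> abV; apply: connect_sub => {}x {}y /and3P[exy xV yV].
apply: connect1; rewrite /del_edge /= exy /=; apply/negP.
by case/orP=> /andP[/eqP xE /eqP yE]; move: abV; rewrite -xE -yE xV yV.
Qed.

Lemma induced_path_connected {n : nat} {e : rel 'I_n} {V : {set 'I_n}} {x : 'I_n} :
  symmetric e -> induced_path_endpoint e V x ->
  {in V &, forall a b, connect (induced e V) a b}.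
Proof.
move=> esym [s [_ [sV sE]]].
have Vsym : connect_sym (induced e V).
  by apply: sym_connect_sym => a b; rewrite /induced /= esym [(_ \in _) && _]andbC.
have sP : path (induced e V) x s.
  apply/(pathP x) => i ltis.
  have [iV jV] : nth x (x :: s) i \in V /\ nth x s i \in V.
    rewrite !sV; split; first by rewrite mem_nth //= ltnW.
    by rewrite inE mem_nth ?orbT.
  rewrite /induced /= iV jV !andbT; apply/sE => //.
  by exists i, x; split; rewrite //=; left.
move=> a b aV bV; apply: (@connect_trans _ _ x).
  by rewrite Vsym; apply: (path_connect sP); rewrite -sV.
by apply: (path_connect sP); rewrite -sV.
Qed.

(** Let [w] be the first vertex of [S] met when walking from [x], and [f] its predecessor. The only
    other possible neighbour of [f] on the path comes earlier, hence lies outside [S]. *)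
Lemma induced_path_entry {n : nat} {e : rel 'I_n} {V S : {set 'I_n}} {x y : 'I_n} :
  induced_path_endpoint e V x -> x \notin S -> y \in V -> y \in S ->
  exists f w, [/\ f \in V, f \notin S, w \in S, e f w &
    forall g, g \in V -> g \in S -> e f g -> g = w].
Proof.
case=> s [sU [sV sE]] xS yV yS.
have hasS : has (mem S) (x :: s) by apply/hasP; exists y; rewrite -?sV.
have ltk := hasS; rewrite has_find in ltk.
have kS := nth_find x hasS.
have before i : (i < find (mem S) (x :: s))%N -> nth x (x :: s) i \notin S.
  by move=> /(before_find x) /= ->.
move: (find _ _) ltk kS before => [|k] ltk kS before; first by rewrite /= (negPf xS) in kS.
have kV : nth x (x :: s) k \in V by rewrite sV mem_nth // ltnW.
have k1V : nth x (x :: s) k.+1 \in V by rewrite sV mem_nth.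
exists (nth x (x :: s) k), (nth x (x :: s) k.+1); split=> //.
- exact: before.
- by apply/sE => //; exists k, x; split=> //; left.
move=> g gV gS /sE [] // i [x0 [lti]].
rewrite !(set_nth_default x x0) //; last exact: ltnW.
case=> -[iE jE]; last first.
  have ik : i.+1 = k by apply/eqP; rewrite -(nth_uniq x _ _ sU) ?jE // ltnW.
  by move: (before i); rewrite iE gS -ik; move/(_ _)/negP; case=> //; rewrite ltnW.
have <- : i = k by apply/eqP; rewrite -(nth_uniq x _ _ sU) ?iE // ltnW.
by [].
Qed.

(** * Path decompositions exclude forts *)

Definition no_fort {n m : nat} (e : rel 'I_n) (v : 'I_m -> 'I_n) : Prop :=
  forall S : {set 'I_n}, S != set0 -> (forall r, v r \notin S) ->
    exists2 i, i \notin S & #|[set j in S | e i j]| == 1.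

Lemma path_decomposition_disjoint {n m : nat} {e : rel 'I_n} {v : 'I_m -> 'I_n}
    {V : 'I_m -> {set 'I_n}} {r s : 'I_m} {x : 'I_n} :
  path_decomposition e v V -> x \in V r -> x \in V s -> r = s.
Proof.
case=> dis _ xr xs; apply/eqP; case: eqP => // /eqP /dis.
by move/disjointFr => /(_ _ xr); rewrite xs.
Qed.

(** A second edge, together with connections inside the two parts, would bypass the first one, which
    is a bridge. *)
Lemma path_decomposition_edges_between {n m : nat} {e : rel 'I_n}
    {v : 'I_m -> 'I_n} {V : 'I_m -> {set 'I_n}} {r s : 'I_m} :
  is_tree e -> path_decomposition e v V -> r != s ->
  (edges_between e (V r) (V s) <= 1)%N.
Proof.
move=> eT VP rs; have [[esym _] _] := eT; have [_ [_ Vend]] := VP.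
apply/card_le1_eqP => -[a b] [c d]; rewrite !inE /=.
move=> /andP[/andP[aV bV] eab] /andP[/andP[cV dV] ecd].
have notV t x y : x \in V r -> y \in V s -> ~~ ((x \in V t) && (y \in V t)).
  move=> xr ys; apply/negP => /andP[xt yt]; case/eqP: rs.
  by rewrite (path_decomposition_disjoint VP xr xt) (path_decomposition_disjoint VP ys yt).
have conn t x y : x \in V t -> y \in V t -> connect (del_edge e a b) x y.
  move=> xt yt; apply: (connect_induced_del_edge (notV t _ _ aV bV)).
  by apply: (induced_path_connected esym (proj2 (Vend t))).
apply/eqP/contraT => neq; case/negP: (tree_edge_is_bridge eT eab).
apply: connect_trans (conn r a c aV cV) _.
apply: connect_trans (conn s d b dV bV); apply: connect1.
rewrite /del_edge /= ecd /=; apply/negP => /orP[]/andP[/eqP ca /eqP db].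
  by case/eqP: neq; rewrite ca db.
by move: (notV r _ _ cV dV); rewrite cV db aV.
Qed.

Lemma exists_periodic {T : finType} (h : T -> T) (P : pred T) (x : T) :
  P x -> (forall y, P y -> P (h y)) -> exists2 y, P y & exists k, iter k.+1 h y = y.
Proof.
move=> Px hP; have /trajectP[i lti iE] := looping_order h x.
exists (iter i h x); first by elim: i {lti iE} => //= i; apply: hP.
exists (order h x - i).-1; rewrite prednK ?subn_gt0 //.
by rewrite -iterD subnK // ltnW.
Qed.

(* If S were a fort, leaving each part that meets S just before its first vertex
   in S along an edge to a vertex of S in another part, and iterating, would
   close up into a cycle of the tree. *)
Lemma path_decomposition_no_fort {n m : nat} {e : rel 'I_n} {v : 'I_m -> 'I_n}
    {V : 'I_m -> {set 'I_n}} :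
  is_tree e -> path_decomposition e v V -> no_fort e v.
Proof.
move=> eT VP S S0 vS; have [[esym _] _] := eT; have [_ [Vcov Vend]] := VP.
case: (pickP [pred i | (i \notin S) && (#|[set j in S | e i j]| == 1)]).
  by move=> i /andP[]; exists i.
move=> fort; exfalso.
pose active := [pred r | [exists y, (y \in V r) && (y \in S)]].
(* [q r] packs the exit vertex, its neighbour in [S] and the part of that neighbour; the value for
   inactive [r] is a dummy. *)
have /fin_all_exists[q qP] r : exists q : 'I_n * 'I_n * 'I_m, active r ->
    [/\ q.1.1 \in V r, q.1.1 \notin S, q.1.2 \in S, e q.1.1 q.1.2 &
        (q.1.2 \in V q.2) && (q.2 != r)].
  case: (boolP (active r)) => [/existsP[y /andP[yV yS]]|_]; last by exists (v r, v r, r).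
  have [f [w [fV fS wS efw wuniq]]] := induced_path_entry (proj2 (Vend r)) (vS r) yV yS.
  (* By the fort property [f] has a second neighbour in [S]; uniqueness of [w] puts it in another
     part. *)
  have : #|[set j in S | e f j] :\ w| != 0.
    move: (fort f); rewrite /= fS (cardsD1 w) inE wS efw /=.
    by rewrite add1n eqSS => /negbT.
  rewrite cards_eq0 => /set0Pn[g]; rewrite !inE => /and3P[gw gS efg].
  have [s gs] := Vcov g; exists (f, g, s) => _ /=; split=> //; rewrite gs /=.
  by apply: contraNneq gw => sr; apply/eqP/wuniq; rewrite // -sr.
pose f r := (q r).1.1; pose g r := (q r).1.2; pose h r := (q r).2.
have hact r : active r -> active (h r).
  by case/qP=> _ _ gS _ /andP[gV _]; apply/existsP; exists (g r); rewrite gV.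
have [r0 r0act] : exists r, active r.
  have [y yS] := set0Pn _ S0; have [r yr] := Vcov y.
  by exists r; apply/existsP; exists y; rewrite yr.
have [r ract [k0 /eqP k0P]] := exists_periodic h active r0 r0act hact.
have iter_ex : exists k, iter k.+1 h r == r by exists k0.
(* With the least period, the closed walk crosses the edge from [f r] to [g r] only once, so the
   rest of it bypasses that bridge. *)
case: (ex_minnP iter_ex) => k /eqP kP kmin {k0 k0P iter_ex}.
have iact i : active (iter i h r) by elim: i => //= i; apply: hact.
have [frV frS grS efg /andP[grV hr]] := qP r ract.
have notV t : ~~ ((f r \in V t) && (g r \in V t)).
  apply/negP => /andP[ft gt]; case/eqP: hr.
  by rewrite (path_decomposition_disjoint VP grV gt) (path_decomposition_disjoint VP ft frV).
have conn t x y : x \in V t -> y \in V t -> connect (del_edge e (f r) (g r)) x y.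
  move=> xt yt; apply: (connect_induced_del_edge (notV t)).
  by apply: (induced_path_connected esym (proj2 (Vend t))).
have walk i : (i <= k)%N ->
    connect (del_edge e (f r) (g r)) (g r) (f (iter i.+1 h r)).
  elim: i => [_|i IHi ltik].
    by apply: (conn (h r)) => //; have [] := qP _ (iact 1%N).
  have [fV fS gS efgi /andP[gV _]] := qP _ (iact i.+1).
  have fV' : f (iter i.+2 h r) \in V (iter i.+2 h r) by have [] := qP _ (iact i.+2).
  apply: connect_trans (IHi (ltnW ltik)) _.
  apply: connect_trans (conn (iter i.+2 h r) _ _ gV fV').
  apply: connect1; rewrite /del_edge /= efgi /=.
  (* Crossing the deleted edge forwards means an early return to [r]; crossing it backwards would
     put an exit vertex in [S]. *)
  apply/negP => /orP[]/andP[/eqP fE /eqP gE].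
    have /eqP/kmin : iter i.+1 h r = r.
      by apply: (path_decomposition_disjoint VP (x := f r)) => //; rewrite -fE.
    by rewrite leqNgt ltik.
  by move: (fS : f (iter i.+1 h r) \notin S); rewrite fE => /negP; apply.
move: (walk k (leqnn k)); rewrite kP; apply/negP.
rewrite (sym_connect_sym (del_edge_sym _ _ _ _ esym)).
exact: tree_edge_is_bridge eT efg.
Qed.

(** * Controllability from the absence of forts *)

Lemma no_fort_SSC (R : realType) {n m : nat} {e : rel 'I_n} {v : 'I_m -> 'I_n} :
  no_fort e v -> SSC R e v.
Proof.
case: n e v => [|n] e v nf M [Msym [Mpos [M0 _]]].
  by apply/eqP; rewrite -leqn0 rank_leq_row.
apply/eqP; rewrite -/(row_free _) -kermx_eq0; apply: contraT => K0.
set B := input_matrix R v in K0; set K := kermx _ in K0.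
have KB (k : nat) : (k < n.+1)%N -> K *m (M ^+ k *m B) = 0.
  move=> ltk; have : K *m ctrb_matrix M B = 0 by apply/sub_kermxP.
  rewrite /ctrb_matrix mul_mxrow -[RHS]mxrow0 => /eq_mxrowP/(_ (Ordinal ltk)).
  by [].
(* The exponent [k.+1] may reach the dimension; Cayley-Hamilton brings the power back to those
   covered by [KB]. *)
have KMK : (K *m M <= K)%MS.
  rewrite sub_kermx /ctrb_matrix mul_mxrow -[X in _ == X]mxrow0; apply/eqP/eq_mxrow => k.
  rewrite mulmxA -[K *m M *m _]mulmxA -[M *m _]/(M * _) -exprS.
  have -> : M ^+ k.+1 = horner_mx M ('X^(k.+1) %% char_poly M).
    rewrite -{1}(horner_mx_X M) -rmorphXn {1}(divp_eq 'X^(k.+1) (char_poly M)).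
    by rewrite rmorphD rmorphM /= Cayley_Hamilton mulr0 add0r.
  set p := _ %% _.
  have szp : (size p <= n.+1)%N.
    by rewrite -ltnS -(size_char_poly M) ltn_modp monic_neq0 ?char_poly_monic.
  rewrite -[p]coefK poly_def rmorph_sum mulmx_sumr mulmx_suml big1 // => i _.
  rewrite /= horner_mxZ rmorphXn /= horner_mx_X -scalemxAr -scalemxAl -mulmxA KB ?scaler0 //.
  exact: leq_trans (ltn_ord i) szp.
have [D KD] := submxP KMK.
pose S := [set i | [exists r, K r i != 0]].
have inS i : i \notin S -> forall r, K r i = 0.
  by rewrite inE negb_exists => /forallP iS r; apply/eqP; rewrite -[_ == _]negbK.
have S0 : S != set0.
  apply: contraNneq K0 => S0; apply/eqP/matrixP => r i; rewrite [RHS]mxE.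
  by apply: inS; rewrite S0 inE.
have vS r : v r \notin S.
  rewrite inE negb_exists; apply/forallP => s; rewrite negbK.
  have /matrixP/(_ s r) := KB 0%N isT; rewrite expr0 mul1mx [LHS]mxE [RHS]mxE => /eqP.
  rewrite (bigD1 (v r)) //= [B _ _]mxE eqxx mulr1 big1 ?addr0 // => i ir.
  by rewrite [B _ _]mxE (negPf ir) mulr0.
(* Column [i] of [K] vanishes, hence so does that of [K *m M = D *m K]; but its entry in row [r]
   reduces to the nonzero term of the unique neighbour [j]. *)
have [i iS /cards1P[j jP]] := nf S S0 vS.
have : j \in [set j in S | e i j] by rewrite jP inE.
rewrite inE => /andP[jS eij]; move: (jS); rewrite inE => /existsP[r Krj].
have ij : i != j by apply: contraNneq iS => ->.
have := mulf_neq0 Krj (lt0r_neq0 (Mpos i j ij eij)); rewrite -{1}Msym [M^T _ _]mxE.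
suff -> : K r j * M j i = (K *m M) r i.
  by rewrite KD mxE big1 ?eqxx // => k _; rewrite (inS i iS) mulr0.
rewrite [RHS]mxE (bigD1 j) //= big1 ?addr0 // => k kj.
have [kS|kS] := boolP (k \in S); last by rewrite (inS k kS) mul0r.
rewrite -Msym [M^T _ _]mxE M0 ?mulr0 //; first by apply: contraNneq iS => ->.
apply: contra kj => eik; have : k \in [set j in S | e i j] by rewrite inE kS.
by rewrite jP inE.
Qed.

(** * Growing paths from the inputs *)

(** The segment of the path between the ends of a chord would bypass the chord, which is a
    bridge. *)
Lemma tree_path_consecutive {n : nat} {e : rel 'I_n} {x : 'I_n} {s : seq 'I_n} :
  is_tree e -> path e x s -> uniq (x :: s) ->
  {in x :: s &, forall a b, e a b <-> consecutive (x :: s) a b}.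
Proof.
move=> eT /(pathP x) sP sU; have [[esym eirr] _] := eT.
have chordless i j : (i < j < size (x :: s))%N ->
    e (nth x (x :: s) i) (nth x (x :: s) j) -> j = i.+1.
  move=> /andP[ltij ltj] eij; apply/eqP; rewrite eqn_leq ltij andbT leqNgt.
  apply/negP => lti1j; case/negP: (tree_edge_is_bridge eT eij).
  have walk d : (i + d < size (x :: s))%N ->
      connect (del_edge e (nth x (x :: s) i) (nth x (x :: s) j))
        (nth x (x :: s) i) (nth x (x :: s) (i + d)).
    elim: d => [|d IHd]; first by rewrite addn0.
    rewrite addnS => ltd; apply: connect_trans (IHd (ltnW ltd)) (connect1 _).
    apply/andP; split; first exact: sP.
    have lti := ltn_trans ltij ltj; have ltd' := ltnW ltd.
    rewrite !(nth_uniq x _ _ sU) //.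
    apply/negP => /orP[]/andP[/eqP ? /eqP ?]; lia.
  by have := walk (j - i)%N; rewrite (subnKC (ltnW ltij)); apply.
move=> a b /(nthP x)[i lti <-] /(nthP x)[j ltj <-]; split=> [eij|].
  case: (ltngtP i j) => [ltij|ltji|ij].
  - exists i, x; have ji := chordless i j _ eij; rewrite ltij ltj in ji.
    by rewrite -ji //; split=> //; left.
  - rewrite esym in eij; exists j, x; have ji := chordless j i _ eij; rewrite ltji lti in ji.
    by rewrite -ji //; split=> //; right.
  - by rewrite ij eirr in eij.
case=> k [x0 [ltk]]; rewrite !(set_nth_default x x0) //; last exact: ltnW.
by case=> -[<- <-]; [|rewrite esym]; apply: (sP k).
Qed.

(** These are the chains of a zero forcing process. By the last clause only the end of a chain can
    have uncovered neighbours, so any forced vertex extends a chain. *)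
Definition forcing_chains {n m : nat} (e : rel 'I_n) (v : 'I_m -> 'I_n)
    (c : 'I_m -> seq 'I_n) : Prop :=
  [/\ forall r, uniq (v r :: c r), forall r, path e (v r) (c r),
      forall r s x, x \in v r :: c r -> x \in v s :: c s -> r = s &
      forall r x y, x \in v r :: c r -> x != last (v r) (c r) -> e x y ->
        exists s, y \in v s :: c s].

(** The uncovered set avoids the inputs; as it is not a fort, some covered [i] has a single
    neighbour [j] in it. Then [i] ends its chain, and appending [j] leaves [i] without uncovered
    neighbours. *)
Lemma no_fort_spanning_chains {n m : nat} {e : rel 'I_n} {v : 'I_m -> 'I_n}
    (c : 'I_m -> seq 'I_n) :
  no_fort e v -> forcing_chains e v c ->
  exists2 c', forcing_chains e v c' & forall x, exists r, x \in v r :: c' r.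
Proof.
move=> nf; pose white (c : 'I_m -> seq 'I_n) := [set x | ~~ [exists r, x \in v r :: c r]].
have [k] := ubnP #|white c|; elim: k c => // k IHk c; rewrite ltnS => cardc cP.
have notwhite x : x \notin white c -> exists r, x \in v r :: c r.
  by rewrite inE negbK => /existsP.
have [white0|] := eqVneq (white c) set0.
  by exists c => // x; apply: notwhite; rewrite white0 inE.
move=> /nf[r|i /notwhite[r ir] /cards1P[j jP]].
  by rewrite inE negbK; apply/existsP; exists r; rewrite mem_head.
have : j \in [set j in white c | e i j] by rewrite jP inE.
rewrite inE => /andP[jw eij]; have jnew s : j \notin v s :: c s.
  by move: jw; rewrite inE negb_exists => /forallP.
have [cU cpath cdis cforce] := cP.
have ilast : i = last (v r) (c r).
  apply/eqP/contraT => /(cforce r i j ir) /(_ eij)[s js].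
  by move: (jnew s); rewrite js.
pose c' s := if s == r then rcons (c r) j else c s.
have c'E s x : (x \in v s :: c' s) = (x \in v s :: c s) || (s == r) && (x == j).
  rewrite /c'; case: eqP => [->|_]; last by rewrite orbF.
  by rewrite !inE mem_rcons inE; rewrite orbCA orbC -orbA.
apply: (IHk c').
  apply: leq_trans cardc; apply: proper_card; apply/properP; split.
    apply/subsetP => x; rewrite !inE !negb_exists => /forallP xc'.
    by apply/forallP => s; apply: contra (xc' s); rewrite c'E => ->.
  by exists j => //; rewrite inE negbK; apply/existsP; exists r; rewrite c'E !eqxx orbT.
split=> [s|s|s t x|s x y].
- rewrite /c'; case: eqP => [->|_] //.
  by rewrite -rcons_cons rcons_uniq jnew cU.
- rewrite /c'; case: eqP => [->|_] //.
  by rewrite rcons_path cpath -ilast.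
- rewrite !c'E => /orP[xs|/andP[/eqP-> /eqP->]] /orP[xt|/andP[/eqP-> /eqP xj]] //.
  + exact: cdis xs xt.
  + by move: (jnew s); rewrite -xj xs.
  + by move: (jnew t); rewrite xt.
- have black z : (exists t, z \in v t :: c t) -> exists t, z \in v t :: c' t.
    by case=> t zt; exists t; rewrite c'E zt.
  rewrite c'E => xs; rewrite /c'; case: (eqVneq s r) xs => [->|sr]; last first.
    by rewrite orbF => xs xl exy; apply/black/(cforce s x y).
  rewrite last_rcons => /orP[xr xj exy|/eqP-> /eqP//].
  have [xl|xl] := eqVneq x (last (v r) (c r)); last exact/black/(cforce r x y).
  have [yw|/notwhite/black//] := boolP (y \in white c).
  have : y \in [set j in white c | e i j] by rewrite inE yw ilast -xl.
  by rewrite jP inE => /eqP->; exists r; rewrite c'E !eqxx orbT.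
Qed.

Lemma no_fort_path_decomposition {n m : nat} {e : rel 'I_n} {v : 'I_m -> 'I_n} :
  is_tree e -> injective v -> no_fort e v ->
  exists V : 'I_m -> {set 'I_n}, path_decomposition e v V.
Proof.
move=> eT vinj nf.
(* The process starts from one-vertex chains, disjoint because [v] is injective. *)
have [|c [cU cpath cdis _] cov] := no_fort_spanning_chains (fun=> [::]) nf.
  split=> // [r s x|r x y]; rewrite !inE; last by move=> ->.
  by move=> /eqP-> /eqP/vinj.
exists (fun r => [set x in v r :: c r]); split; [|split].
- move=> r s rs; rewrite disjoint_subset; apply/subsetP => x; rewrite !in_set.
  move=> xr; rewrite inE in_set; apply: contra rs => xs; apply/eqP; exact: cdis xr xs.
- by move=> y; have [r yr] := cov y; exists r; rewrite inE.
- move=> r; split; first by rewrite in_set mem_head.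
  exists (c r); split; [exact: cU|split] => [y|a b]; first by rewrite in_set.
  by rewrite !in_set => ar br; apply: tree_path_consecutive (cpath r) (cU r) _ _ ar br.
Qed.

(** * An uncontrollable matrix built from a fort *)

Section Fort.

Variables (R : realType) (n : nat) (e : rel 'I_n) (S : {set 'I_n}).
Hypothesis eT : is_tree e.
Hypothesis fort : forall i, i \notin S -> #|[set j in S | e i j]| != 1.

Let esym : symmetric e. Proof. by case: eT => -[]. Qed.
Let eirr : irreflexive e. Proof. by case: eT => -[]. Qed.

(** The neighbour in [S] that is to balance all the others in the equation at [z]; the default is
    irrelevant once [sees z] holds. *)
Let pivot z := odflt z [pick j | (j \in S) && e z j].
Let sees z := (z \notin S) && [exists j, (j \in S) && e z j].

Let seesP z : sees z -> [/\ z \notin S, pivot z \in S & e z (pivot z)].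
Proof.
case/andP=> zS /existsP[j jP]; rewrite /pivot.
by case: pickP => [k /andP[]|/(_ j)]; rewrite ?jP.
Qed.

(* Every vertex outside [S] with neighbours in [S] must see both signs, so the
   sign flips exactly across the edges [z -- pivot z], which are bridges. *)
Let sgn i : R :=
  \prod_(z | sees z) (-1) ^+ (connect (del_edge e z (pivot z)) z i).

Let sgn_neq0 i : sgn i != 0.
Proof. by apply/prodf_neq0 => z _; rewrite signr_eq0. Qed.

Let connect_across z y j : sees y -> z \notin S -> j \in S -> e z j ->
  (y != z) || (j != pivot z) ->
  connect (del_edge e y (pivot y)) y z = connect (del_edge e y (pivot y)) y j.
Proof.
move=> /seesP[yS pS _] zS jS ezj neq; apply: same_connect1r.
  exact/sym_connect_sym/del_edge_sym.
rewrite /del_edge /= ezj /=; apply/negP => /orP[]/andP[/eqP zE /eqP jE].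
  by move: neq; rewrite jE zE !eqxx.
by move: zS; rewrite zE pS.
Qed.

Let sees_edge z j : z \notin S -> j \in S -> e z j -> sees z.
Proof. by move=> zS jS ezj; rewrite /sees zS; apply/existsP; exists j; rewrite jS. Qed.

Let sgn_same z j : z \notin S -> j \in S -> e z j -> j != pivot z -> sgn j = sgn z.
Proof.
move=> zS jS ezj jp; apply: eq_bigr => y yP; congr (_ ^+ _).
by rewrite (connect_across z y j) // jp orbT.
Qed.

(** Only the factor of [z] differs: every other deleted edge leaves [z] and [pivot z] adjacent. *)
Let sgn_pivot z : sees z -> sgn (pivot z) = - sgn z.
Proof.
move=> zs; have [zS pS ezp] := seesP z zs.
rewrite /sgn (bigD1 z) //= [in RHS](bigD1 z) //=.
rewrite connect0 (negPf (tree_edge_is_bridge eT ezp)) mulN1r opprK mul1r.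
apply: eq_bigr => y /andP[ys yz]; congr (_ ^+ _).
by rewrite (connect_across z y (pivot z)) // yz.
Qed.

(** The pivot has the opposite sign, so its weight must equal the number of the other neighbours in
    [S]; the fort property makes that number positive. *)
Let wgt z j : R := if j == pivot z then (#|[set k in S | e z k]|.-1)%:R else 1.

Let wgt_gt0 z j : z \notin S -> j \in S -> e z j -> 0 < wgt z j.
Proof.
move=> zS jS ezj; rewrite /wgt; case: ifP => // _; rewrite ltr0n.
have : (0 < #|[set k in S | e z k]|)%N.
  by apply/card_gt0P; exists j; rewrite inE jS.
by move: (fort z zS); case: #|_| => [|[]].
Qed.

Let w i j : R :=
  if ~~ e i j then 0
  else if (i \notin S) && (j \in S) then wgt i j
  else if (j \notin S) && (i \in S) then wgt j i else 1.

Let wC i j : w i j = w j i.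
Proof. by rewrite /w esym; case: (i \in S); case: (j \in S). Qed.

Let w_gt0 i j : e i j -> 0 < w i j.
Proof.
move=> eij; rewrite /w eij /=.
case: ifP => [/andP[iS jS]|_]; first exact: wgt_gt0.
by case: ifP => [/andP[jS iS]|_] //; apply: wgt_gt0; rewrite // esym.
Qed.

Let x i : R := if i \in S then sgn i else 0.

Let balanced z : z \notin S -> \sum_i x i * w i z = 0.
Proof.
move=> zS; have [zs|zs] := boolP (sees z); last first.
  apply: big1 => j _; rewrite /x; case: ifP => [jS|_]; last by rewrite mul0r.
  rewrite /w esym; case: ifP => [_|/negbFE ezj]; first by rewrite mulr0.
  by case/negP: zs; apply: sees_edge jS ezj.
have [_ pS ezp] := seesP z zs.
have -> : \sum_i x i * w i z = \sum_(i in [set k in S | e z k]) sgn i * wgt z i.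
  rewrite [RHS]big_mkcond; apply: eq_bigr => i _; rewrite inE /x /w esym.
  case: (i \in S); last by rewrite mul0r.
  by case: (e z i); rewrite /= ?mulr0 // (negPf zS).
have pin : pivot z \in [set k in S | e z k] by rewrite inE pS.
rewrite (bigD1 (pivot z)) //= sgn_pivot // {1}/wgt eqxx.
rewrite (eq_bigr (fun=> sgn z)); last first.
  move=> i /andP[]; rewrite inE => /andP[iS ezi] ip.
  by rewrite /wgt (negPf ip) mulr1 (sgn_same z i).
rewrite sumr_const mulNr -[in X in _ + X]mulr_natr; apply/eqP.
rewrite addrC subr_eq0; apply/eqP; congr (_ * _%:R).
rewrite [in RHS](cardD1 (pivot z)) pin add1n /=; apply: eq_card => i.
by rewrite [RHS]inE; apply: andbC.
Qed.

(** The diagonal entry that solves the equation at [j] in [S] for eigenvalue zero. *)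
Let dg j : R := if j \in S then - (\sum_i x i * w i j) / x j else 0.

(** Subtracting a constant from the diagonal keeps the eigenvector. This one exceeds every self-loop
    weight, making all of them negative; the summand 1 gives strictness. *)
Let shift : R := 1 + \sum_i `|dg i + \sum_(j | e i j) w i j|.

Let M : 'M[R]_n := \matrix_(i, j) (w i j + (dg i - shift) *+ (i == j)).

Let wii i : w i i = 0. Proof. by rewrite /w eirr. Qed.

Lemma fort_matrix_in_Q : in_Q e M.
Proof.
have ME i j : i != j -> M i j = w i j by move=> ij; rewrite mxE (negPf ij) addr0.
split; [|split; [|split]] => [|i j ij eij|i j ij eij|i].
- apply/matrixP => i j; rewrite !mxE wC eq_sym.
  by case: eqP => [->|_]; rewrite ?mulr0n.
- by rewrite ME ?w_gt0.
- by rewrite ME // /w eij.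
exists (dg i + \sum_(j | e i j) w i j - shift); split.
  rewrite subr_lt0 /shift [X in _ < _ + X](bigD1 i) //=; apply: le_lt_trans (ler_norm _) _.
  by rewrite addrCA ltrDl ltr_wpDr ?ltr01 ?sumr_ge0.
rewrite (eq_bigr (fun j => w i j)) => [|j eij]; last first.
  by rewrite ME //; apply: contraTneq eij => ->; rewrite eirr.
by rewrite mxE wii eqxx mulr1n; ring.
Qed.

Let u : 'rV[R]_n := \row_i x i.

Lemma fort_eigenvector : u *m M = - shift *: u.
Proof.
apply/rowP => j; rewrite !mxE.
under eq_bigr do rewrite !mxE mulrDr mulrnAr.
rewrite big_split /= [X in _ + X](bigD1 j) //= eqxx mulr1n.
rewrite [X in _ + (_ + X)]big1 ?addr0; last by move=> i ij; rewrite (negPf ij) mulr0n.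
have [jS|jS] := boolP (j \in S); last by rewrite balanced // /x (negPf jS) mul0r mulr0 add0r.
rewrite /dg jS; have : x j != 0 by rewrite /x jS sgn_neq0.
by move=> xj; field.
Qed.

(** The eigenvector [u] is supported on [S], so it annihilates the input matrix, hence every block
    of the controllability matrix. *)
Lemma fort_not_SSC (m : nat) (v : 'I_m -> 'I_n) :
  S != set0 -> (forall r, v r \notin S) -> ~ SSC R e v.
Proof.
move=> S0 vS /(_ M fort_matrix_in_Q)/eqP; rewrite -/(row_free _) => free.
have [i iS] := set0Pn _ S0.
have : u = 0.
  apply/(row_free_inj free); rewrite mul0mx /ctrb_matrix mul_mxrow -[RHS]mxrow0.
  apply/eq_mxrow => k.
  have -> : u *m (M ^+ k *m input_matrix R v) = (- shift) ^+ k *: (u *m input_matrix R v).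
    rewrite mulmxA scalemxAl; congr (_ *m _); elim: (k : nat) => [|l IHl].
      by rewrite !expr0 mulmx1 scale1r.
    by rewrite exprSr mulmxA IHl -scalemxAl fort_eigenvector scalerA -exprSr.
  suff -> : u *m input_matrix R v = 0 by rewrite scaler0.
  apply/rowP => r; rewrite !mxE big1 // => j _; rewrite !mxE.
  by case: eqP => [->|_]; rewrite ?mulr0 // /x (negPf (vS r)) mul0r.
by move/rowP/(_ i); rewrite !mxE /x iS => /eqP; rewrite (negPf (sgn_neq0 i)).
Qed.

End Fort.

Lemma SSC_no_fort {R : realType} {n m : nat} {e : rel 'I_n} {v : 'I_m -> 'I_n} :
  is_tree e -> SSC R e v -> no_fort e v.
Proof.
move=> eT vSSC S S0 vS.
case: (pickP [pred i | (i \notin S) && (#|[set j in S | e i j]| == 1)]).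
  by move=> i /andP[]; exists i.
move=> fort; case: (fort_not_SSC R n e S eT _ m v S0 vS vSSC) => i iS.
by have := fort i; rewrite /= iS => /negbT.
Qed.

Theorem theorem2 (R : realType) (n m : nat) (e : rel 'I_n) (v : 'I_m -> 'I_n) :
  is_tree e -> (2 <= m)%N -> injective v ->
  (SSC R e v <-> exists V : 'I_m -> {set 'I_n}, path_decomposition e v V) /\
  (forall V : 'I_m -> {set 'I_n}, path_decomposition e v V ->
     forall r s : 'I_m, r != s -> (edges_between e (V r) (V s) <= 1)%N).
Proof.
move=> eT _ vinj; split; last by move=> V VP r s; apply: path_decomposition_edges_between eT VP.
split=> [/(SSC_no_fort eT)/(no_fort_path_decomposition eT vinj) //|[V VP]].
exact/no_fort_SSC/(path_decomposition_no_fort eT VP).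
Qed.
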